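(* Let $I$ be an $\mathcal{A}$-homogeneous ideal of $R$ and let $(\mathbf{F}_\bullet,\phi)$ be a minimal $\mathcal{A}$-graded free resolution of $R/I$. Then there exists a system of bases $\mathbf{B}$ for $\mathbf{F}_\bullet$ such that $(\mathbf{F}_\bullet,\phi,\mathbf{B})$ is simple.
   Context: Setting. Let $\mathcal{L}\subset\mathbb{Z}^n$ be a lattice (subgroup) with $\mathcal{L}\cap\mathbb{N}^n=\{\mathbf{0}\}$, and let $\mathcal{A}$ be the subsemigroup (containing $0$) of $\mathbb{Z}^n/\mathcal{L}$ generated by $\mathbf{a}_i=\mathbf{e}_i+\mathcal{L}$, $1\le i\le n$, where $\mathbf e_1,\dots,\mathbf e_n$ is the canonical basis of $\mathbb{Z}^n$. Let $\Bbbk$ be a field and $R=\Bbbk[x_1,\dots,x_n]$, multigraded by $\mathcal{A}$ via $\deg_{\mathcal{A}}(x_1^{v_1}\cdots x_n^{v_n})=v_1\mathbf{a}_1+\cdots+v_n\mathbf{a}_n$. An ideal is $\mathcal{A}$-homogeneous if it is generated by polynomials each of whose monomial terms all have the same $\mathcal{A}$-degree. A minimal $\mathcal{A}$-graded free resolution of $R/I$ is an exact complex $0\to F_p\xrightarrow{\phi_p}\cdots\to F_1\xrightarrow{\phi_1}F_0\xrightarrow{\phi_0}R/I\to 0$ of finite rank $\mathcal{A}$-graded free modules with degree-preserving maps and $\phi_i(F_i)\subset (x_1,\dots,x_n)F_{i-1}$ for $i\ge1$. A system of bases $\mathbf{B}=(B_i)$ consists of an $\mathcal{A}$-homogeneous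 basis $B_i$ of $F_i$ for each $i\ge 0$. Simplicity. Let $F$ be an $\mathcal{A}$-graded free module with $\mathcal{A}$-homogeneous basis $B=\{E_t\}$. For an $\mathcal{A}$-homogeneous $h=\sum_t\big(\sum_{\mathbf a} c_{t,\mathbf{a}}\mathbf{x}^{\mathbf{a}}\big)E_t\in F$ put $S_B(h)=\{\mathbf{x}^{\mathbf{a}}E_t: c_{t,\mathbf{a}}\ne0\}$, and write $h'<h$ if $S_B(h')\subsetneq S_B(h)$. For an $\mathcal{A}$-graded subset $G\subset F$, a nonzero $\mathcal{A}$-homogeneous $h\in G$ is simple in $G$ with respect to $B$ if there is no nonzero $\mathcal{A}$-homogeneous $h'\in G$ with $h'<h$. The based resolution $(\mathbf{F}_\bullet,\phi,\mathbf{B})$ is simple if for each $i\ge1$ and each $E\in B_i$, the element $\phi_i(E)$ is simple in $\ker\phi_{i-1}$ with respect to $B_{i-1}$. *)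

(* Defs.v *)
From HB Require Import structures.
From mathcomp Require Import all_boot all_order all_algebra.
From mathcomp Require Import mpoly.
Set Implicit Arguments.
Unset Strict Implicit.
Unset Printing Implicit Defensive.
Import GRing.Theory.
Local Open Scope ring_scope.
Local Open Scope quotient_scope.

(* MathComp only provides the quotient of a zmodType by a subgroup and of a
   ring by a proper ideal; here a module is divided by any submodule. *)
Section QuotientModule.
Variables (R : nzRingType) (V : lmodType R) (N : submodClosed V).

(* The hierarchy does not derive zmodClosed from submodClosed. *)
Definition submod_sub : V -> bool := fun x => x \in N.

Lemma submod_sub_closed : zmod_closed submod_sub.
Proof.
split=> [|x y xN yN]; first exact: (rpred0 N).
have: x - y \in N by rewrite -scaleN1r rpredD // rpredZ.
by [].
Qed.

HB.instance Definition _ := GRing.isZmodClosed.Build V submod_sub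
  submod_sub_closed.

Definition submod_zmod : zmodClosed V :=
  GRing.ZmodClosed.clone V submod_sub _.

Definition quotmod : Type := Quotient.quot submod_zmod.
HB.instance Definition _ := GRing.Zmodule.on quotmod.

Definition quotmod_pi : V -> quotmod := \pi_(Quotient.quot submod_zmod).

Lemma quotmod_piD : {morph quotmod_pi : x y / x + y}.
Proof. by move=> x y; rewrite /quotmod_pi raddfD. Qed.

Lemma quotmod_piP x y : reflect (quotmod_pi x = quotmod_pi y) (x - y \in N).
Proof.
have -> : (x - y \in N) = (x - y \in submod_zmod) by [].
by rewrite Quotient.idealrBE; apply: eqP.
Qed.

Definition quotmod_scale (a : R) (q : quotmod) : quotmod :=
  quotmod_pi (a *: (repr (q : Quotient.quot submod_zmod) : V)).

Lemma quotmod_reprK (q : quotmod) :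
  quotmod_pi (repr (q : Quotient.quot submod_zmod) : V) = q.
Proof. exact: (@reprK V (Quotient.quot submod_zmod)). Qed.

Lemma quotmod_piZ a x : quotmod_scale a (quotmod_pi x) = quotmod_pi (a *: x).
Proof.
apply/quotmod_piP; rewrite -scalerBr rpredZ //.
by apply/quotmod_piP; rewrite quotmod_reprK.
Qed.

Lemma quotmod_scaleA a b q :
  quotmod_scale a (quotmod_scale b q) = quotmod_scale (a * b) q.
Proof. by rewrite -(quotmod_reprK q) !quotmod_piZ scalerA. Qed.

Lemma quotmod_scale1 : left_id 1 quotmod_scale.
Proof. by move=> q; rewrite -(quotmod_reprK q) quotmod_piZ scale1r. Qed.

Lemma quotmod_scaleDr : right_distributive quotmod_scale +%R.
Proof.
move=> a p q; rewrite -(quotmod_reprK p) -(quotmod_reprK q).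
by rewrite -quotmod_piD !quotmod_piZ scalerDr quotmod_piD.
Qed.

Lemma quotmod_scaleDl q : {morph quotmod_scale^~ q : a b / a + b}.
Proof.
move=> a b /=; rewrite -(quotmod_reprK q) !quotmod_piZ.
by rewrite -quotmod_piD scalerDl.
Qed.

HB.instance Definition _ := GRing.Zmodule_isLmodule.Build R quotmod
  quotmod_scaleA quotmod_scale1 quotmod_scaleDr quotmod_scaleDl.
End QuotientModule.

Section Grading.
Variables (K : fieldType) (n : nat) (L : zmodClosed 'rV[int]_n).
Local Notation R := {mpoly K[n]}.

Definition pointed_lattice : Prop :=
  forall v : 'rV[int]_n, v \in L -> (forall j, 0 <= v 0 j) -> v = 0.

(* The ambient group Z^n / L of the semigroup A. *)
Definition deggrp : zmodType := Quotient.quot L.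

Definition agen (i : 'I_n) : deggrp := \pi_(Quotient.quot L) (delta_mx 0 i).

Definition adeg (u : 'X_{1..n}) : deggrp := \sum_(i < n) agen i *+ u i.

Definition in_A (a : deggrp) : Prop := exists u : 'X_{1..n}, a = adeg u.

(* The zero polynomial belongs to R_a for every a. *)
Definition ahomog (a : deggrp) (f : R) : Prop :=
  forall u, u \in msupp f -> adeg u = a.

Definition in_ideal_gen (G : R -> Prop) (f : R) : Prop :=
  exists (m : nat) (c g : 'I_m -> R),
    (forall j, G (g j)) /\ f = \sum_(j < m) c j * g j.

Definition homog_ideal (I : submodClosed R^o) : Prop :=
  exists G : R -> Prop,
    (forall g, G g -> exists a, ahomog a g) /\
    (forall f : R, (f \in I) <-> in_ideal_gen G f).

(* Degrees are taken in the group Z^n / L, and gm_inA keeps those of nonzero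
   elements inside A; closure under opposites and K-scaling is contained in
   gm_scale since the constants are homogeneous of degree 0. *)
Record gmodule := GModule {
  gm_sort :> lmodType R;
  gm_piece : deggrp -> gm_sort -> Prop;
  gm_piece0 : forall a, gm_piece a 0;
  gm_pieceD : forall a x y,
    gm_piece a x -> gm_piece a y -> gm_piece a (x + y);
  gm_scale : forall b a f x,
    ahomog b f -> gm_piece a x -> gm_piece (b + a) (f *: x);
  gm_inA : forall a x, gm_piece a x -> x != 0 -> in_A a;
  gm_decomp : forall x, exists (s : seq deggrp) (c : deggrp -> gm_sort),
    (forall a, gm_piece a (c a)) /\ x = \sum_(a <- s) c a;
  gm_direct : forall (s : seq deggrp) (c : deggrp -> gm_sort),
    uniq s -> (forall a, gm_piece a (c a)) ->
    \sum_(a <- s) c a = 0 -> forall a, a \in s -> c a = 0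
}.

Definition ghomog (M : gmodule) (x : M) : Prop := exists a, gm_piece a x.

Record hbasis (M : gmodule) := HBasis {
  hb_rank : nat;
  hb_vec :> 'I_hb_rank -> M;
  hb_homog : forall t, ghomog (hb_vec t);
  hb_basis : forall x : M, exists! c : {ffun 'I_hb_rank -> R},
    x = \sum_(t < hb_rank) c t *: hb_vec t
}.

Lemma hb_coord_ex (M : gmodule) (B : hbasis M) (x : M) :
  exists c : {ffun 'I_(hb_rank B) -> R}, x == \sum_t c t *: B t.
Proof. by case: (hb_basis B x) => c [/eqP xE _]; exists c. Qed.

Definition hb_coord (M : gmodule) (B : hbasis M) (x : M) :
  {ffun 'I_(hb_rank B) -> R} := xchoose (hb_coord_ex B x).
Arguments hb_coord {M} B x.

(* S_B(h); the pair (u, t) stands for the element 'X_[u] *: B t. *)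
Definition bsupp (M : gmodule) (B : hbasis M) (h : M) :
  pred ('X_{1..n} * 'I_(hb_rank B)) :=
  fun ut => ut.1 \in msupp (hb_coord B h ut.2).
Arguments bsupp {M} B h.

Definition bsupp_lt (M : gmodule) (B : hbasis M) (h' h : M) : Prop :=
  (forall ut, bsupp B h' ut -> bsupp B h ut) /\
  (exists ut, bsupp B h ut && ~~ bsupp B h' ut).

Definition simple_in (M : gmodule) (B : hbasis M) (G : M -> Prop) (h : M) :
  Prop :=
  [/\ G h, h <> 0, ghomog h &
      ~ exists h' : M, [/\ G h', h' <> 0, ghomog h' & bsupp_lt B h' h]].

Definition quot_piece (I : submodClosed R^o) (a : deggrp) (q : quotmod I) :
  Prop := exists f : R, ahomog a f /\ q = quotmod_pi I f.

Definition in_mM (M : lmodType R) (x : M) : Prop :=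
  exists w : 'I_n -> M, x = \sum_(j < n) 'X_j *: w j.

(* mr_diff i is phi_(i+1), and mr_aug is phi_0; the complex of length p is
   continued by zero modules. *)
Record min_resolution (I : submodClosed R^o) := MinResolution {
  mr_mod :> nat -> gmodule;
  mr_aug : {linear mr_mod 0%N -> quotmod I};
  mr_diff : forall i : nat, {linear mr_mod i.+1 -> mr_mod i};
  mr_free : forall i, inhabited (hbasis (mr_mod i));
  mr_length : exists p : nat, forall i, (p < i)%N ->
    forall x : mr_mod i, x = 0;
  mr_aug_deg : forall a (x : mr_mod 0%N),
    gm_piece a x -> quot_piece a (mr_aug x);
  mr_diff_deg : forall i a (x : mr_mod i.+1),
    gm_piece a x -> gm_piece a (mr_diff i x);
  mr_aug_surj : forall q : quotmod I, exists x : mr_mod 0%N, mr_aug x = q;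
  mr_exact0 : forall x : mr_mod 0%N,
    mr_aug x = 0 <-> exists y, mr_diff 0%N y = x;
  mr_exactS : forall i (x : mr_mod i.+1),
    mr_diff i x = 0 <-> exists y, mr_diff i.+1 y = x;
  mr_minimal : forall i (x : mr_mod i.+1), in_mM (mr_diff i x)
}.

Definition mr_ker (I : submodClosed R^o) (F : min_resolution I) (i : nat) :
  F i -> Prop :=
  match i return F i -> Prop with
  | 0%N => fun x => mr_aug F x = 0
  | j.+1 => fun x => mr_diff F j x = 0
  end.

Definition simple_resolution (I : submodClosed R^o) (F : min_resolution I)
    (B : forall i, hbasis (F i)) : Prop :=
  forall i (t : 'I_(hb_rank (B i.+1))),
    simple_in (B i) (@mr_ker I F i) (mr_diff F i (B i.+1 t)).
End Grading.

(* Main.v *)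
(* A homogeneous basis [C] of [F_(i+1)] is made simple one vector at a time.
   The constant coefficient of the [C t]-coordinate vanishes on the kernel of
   the differential, by minimality.  Among the homogeneous elements of the same
   degree as [C t] where it does not vanish, one whose image has minimal support
   has a simple image.  Its [C t]-coordinate has degree 0, hence is a nonzero
   constant because the lattice is pointed, so the element can replace [C t]
   without changing the other basis vectors. *)
Require Import Defs.
From mathcomp Require Import all_boot all_order all_algebra.
From mathcomp Require Import mpoly.
From Stdlib Require Import Classical ClassicalEpsilon.
Set Implicit Arguments.
Unset Strict Implicit.
Unset Printing Implicit Defensive.
Import GRing.Theory.
Local Open Scope ring_scope.

(** * Replacing one vector of a free basis *)

Section FreeExchange.
Variables (R : comNzRingType) (V : lmodType R) (m : nat).
Implicit Types (v : 'I_m -> V) (c r : {ffun 'I_m -> R}).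

Definition free_basis v : Prop :=
  forall x : V, exists! c : {ffun 'I_m -> R}, x = \sum_t c t *: v t.

Definition exchange v (t : 'I_m) (y : V) : 'I_m -> V :=
  fun s => if s == t then y else v s.

Lemma exchange_free_basis v t r k :
  free_basis v -> k * r t = 1 ->
  free_basis (exchange v t (\sum_s r s *: v s)).
Proof.
move=> vP krt x.
(* [old] turns coordinates in the exchanged family into coordinates in [v]; [new] is its inverse,
   where [k] stands for division by [r t]. *)
pose old c : {ffun 'I_m -> R} :=
  [ffun s => if s == t then c t * r t else c s + c t * r s].
pose new c : {ffun 'I_m -> R} :=
  [ffun s => if s == t then c t * k else c s - c t * k * r s].
have oldK : cancel old new.
  move=> c; apply/ffunP=> s; rewrite !ffunE eqxx.
  case: eqP => [->|_]; first by rewrite -mulrA (mulrC (r t)) krt mulr1.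
  by rewrite -(mulrA (c t)) (mulrC (r t)) krt mulr1 addrK.
have newK : cancel new old.
  move=> c; apply/ffunP=> s; rewrite !ffunE eqxx.
  case: eqP => [->|_]; first by rewrite -mulrA krt mulr1.
  by rewrite subrK.
have sumE c : \sum_s c s *: exchange v t (\sum_s r s *: v s) s
            = \sum_s old c s *: v s.
  rewrite (bigD1 t) //= /exchange eqxx (bigD1 t) //= scalerDr scalerA.
  rewrite [RHS](bigD1 t) //= ffunE eqxx -addrA; congr (_ + _).
  rewrite scaler_sumr -big_split /=; apply: eq_bigr => s /negPf st.
  by rewrite ffunE st scalerDl scalerA addrC.
have [c [xE cU]] := vP x; exists (new c); split=> [|c' xE'].
  by rewrite sumE newK.
by rewrite (cU (old c')) ?oldK // -sumE.
Qed.

End FreeExchange.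

(** * Degrees and graded components *)

Section Graded.
Variables (K : fieldType) (n : nat) (L : zmodClosed 'rV[int]_n).
Local Notation R := {mpoly K[n]}.
Implicit Types M N : gmodule K L.

Lemma ahomogX u (c : K) : ahomog (adeg L u) (c *: 'X_[u] : R).
Proof.
move=> w; rewrite mcoeff_msupp mcoeffZ mcoeffX.
by have [->//|_] := eqVneq u w; rewrite mulr0 eqxx.
Qed.

Lemma ahomogC (c : K) : ahomog (0 : deggrp L) (c%:MP : R).
Proof.
move=> w; rewrite msuppC; case: ifP => // _; rewrite inE => /eqP->.
by rewrite /adeg big1 // => i _; rewrite mnm0E mulr0n.
Qed.

(** The exponents of [u], read as an integer vector, form a nonnegative element of [L], which
    pointedness forces to vanish. *)
Lemma adeg_eq0 u : pointed_lattice L -> adeg L u = 0 -> u = 0%MM.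
Proof.
move=> hL; pose v : 'rV[int]_n := \sum_i delta_mx 0 i *+ u i.
have vE j : v 0 j = (u j)%:Z.
  rewrite /v summxE (bigD1 j) //= big1 => [|i /negPf ij].
    by rewrite mulmxnE mxE !eqxx addr0 -natz.
  by rewrite mulmxnE mxE eqxx eq_sym ij mul0rn.
have -> : adeg L u = (\pi_(Quotient.quot L)%qT v : deggrp L).
  rewrite /v raddf_sum; by apply: eq_bigr => i _; rewrite raddfMn.
move=> vL0.
have vL : v \in L.
  rewrite -[v]subr0 Quotient.idealrBE; apply/eqP.
  by rewrite vL0 raddf0.
have v0 : v = 0 by apply: hL => // j; rewrite vE.
by apply/mnmP=> j; apply/eqP; rewrite -eqz_nat -vE v0 mxE mnm0E.
Qed.

Lemma ahomog0_const f : pointed_lattice L -> ahomog (0 : deggrp L) f ->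
  f = (f@_0)%:MP :> R.
Proof.
move=> hL f0; apply/mpolyP=> u; rewrite mcoeffC.
have [-> | u0] := eqVneq u 0%MM; first by rewrite mulr1.
rewrite mulr0; apply/eqP/negPn; rewrite -mcoeff_msupp.
by apply: contra u0 => /f0 /(adeg_eq0 hL)->.
Qed.

Lemma gm_pieceZ M a (c : K) (x : M) : gm_piece a x -> gm_piece a (c%:MP *: x).
Proof. by move=> /(gm_scale (@ahomogC c)); rewrite add0r. Qed.

Lemma gm_pieceB M a (x y : M) :
  gm_piece a x -> gm_piece a y -> gm_piece a (x - y).
Proof.
move=> xa /(gm_pieceZ (-1)) ya; rewrite -[- y]scaleN1r -mpolyC1 -mpolyCN.
exact: gm_pieceD.
Qed.

Lemma gm_piece_sum M a (T : Type) (r : seq T) (P : pred T) (x : T -> M) :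
  (forall i, P i -> gm_piece a (x i)) -> gm_piece a (\sum_(i <- r | P i) x i).
Proof.
move=> xa; elim/big_ind: _ => //; [exact: gm_piece0|exact: gm_pieceD].
Qed.

(** Directness of the grading allows the two sides of the expansion to be compared in degree [a]
    alone. *)
Lemma gm_component M (T : eqType) (r : seq T) (deg : T -> deggrp L)
    (x : T -> M) a (h : M) :
  (forall i, gm_piece (deg i) (x i)) -> gm_piece a h ->
  h = \sum_(i <- r) x i -> h = \sum_(i <- r | deg i == a) x i.
Proof.
(* [a] is added by hand, since [h] counts in degree [a] even when no [x i] does. *)
move=> xdeg ha hE; pose s := undup (a :: map deg r).
have sumD (y : M) b0 : b0 \in s -> \sum_(b <- s | b0 == b) y = y.
  move=> b0s; rewrite big_mkcond (bigD1_seq b0) ?undup_uniq //= eqxx.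
  rewrite big1 ?addr0 //.
  by move=> b /negPf bb0; rewrite eq_sym bb0.
(* The degree [b] part of the sum minus [h]; these parts add up to zero over [s]. *)
pose e b := \sum_(i <- r | deg i == b) x i - (if a == b then h else 0).
have as_ : a \in s by rewrite mem_undup mem_head.
have /eqP : e a = 0.
  apply: (gm_direct (undup_uniq _) _ _ as_) => [b|].
    apply: gm_pieceB; last by case: eqP => [<-|_] //; apply: gm_piece0.
    by apply: gm_piece_sum => i /eqP<-.
  rewrite sumrB -big_mkcond sumD //.
  rewrite [X in _ - X]hE; apply/eqP; rewrite subr_eq0; apply/eqP.
  rewrite (exchange_big_dep xpredT) //=; apply: eq_big_seq => i ir.
  by rewrite sumD // mem_undup inE map_f ?orbT.
by rewrite /e eqxx subr_eq0 => /eqP.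
Qed.

(** * Coordinates and supports in a homogeneous basis *)

Section Coord.
Variables (M : gmodule K L) (B : hbasis M).

Lemma hb_coordE x : x = \sum_t hb_coord B x t *: B t.
Proof. exact/eqP/(xchooseP (hb_coord_ex B x)). Qed.

Lemma hb_coord_uniq x (c : {ffun 'I_(hb_rank B) -> R}) :
  x = \sum_t c t *: B t -> hb_coord B x = c.
Proof.
move=> xE; have [d [_ dU]] := hb_basis B x.
by rewrite -(dU c xE) (dU _ (hb_coordE x)).
Qed.

Lemma hb_coordD x y t : hb_coord B (x + y) t = hb_coord B x t + hb_coord B y t.
Proof.
rewrite (@hb_coord_uniq _ [ffun s => hb_coord B x s + hb_coord B y s]) ?ffunE //.
rewrite {1}(hb_coordE x) {1}(hb_coordE y) -big_split /=.
by apply: eq_bigr => s _; rewrite ffunE scalerDl.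
Qed.

Lemma hb_coordZ a x t : hb_coord B (a *: x) t = a * hb_coord B x t.
Proof.
rewrite (@hb_coord_uniq _ [ffun s => a * hb_coord B x s]) ?ffunE //.
rewrite {1}(hb_coordE x) scaler_sumr.
by apply: eq_bigr => s _; rewrite ffunE scalerA.
Qed.

Lemma hb_coord0 t : hb_coord B 0 t = 0.
Proof. by rewrite -[0 in LHS](scale0r (0 : M)) hb_coordZ mul0r. Qed.

Lemma hb_coord_sum (T : Type) (r : seq T) (x : T -> M) t :
  hb_coord B (\sum_(i <- r) x i) t = \sum_(i <- r) hb_coord B (x i) t.
Proof.
by elim/big_rec2: _ => [|i y z _ <-]; rewrite ?hb_coord0 ?hb_coordD.
Qed.

Lemma hb_coordB x y t : hb_coord B (x - y) t = hb_coord B x t - hb_coord B y t.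
Proof. by rewrite hb_coordD -scaleN1r hb_coordZ mulN1r. Qed.

Lemma hb_coord_vec t s : hb_coord B (B t) s = (s == t)%:R.
Proof.
rewrite (@hb_coord_uniq _ [ffun s => (s == t)%:R]) ?ffunE //.
rewrite (bigD1 t) //= ffunE eqxx scale1r big1 ?addr0 // => i /negPf it.
by rewrite ffunE it scale0r.
Qed.

(** Dropping from the expansion of [x] all terms of degree other than [a] does not change the sum,
    so by uniqueness of coordinates no such terms occur. *)
Lemma hb_coord_homog a b x t : gm_piece a x -> gm_piece b (B t) ->
  ahomog (a - b) (hb_coord B x t).
Proof.
move=> xa tb.
have dP s : {d | gm_piece d (B s)}.
  by apply: constructive_indefinite_description; apply: hb_homog.
(* Forcing the value [b] at [t] avoids proving that the degree of [B t] is unique. *)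
pose d s := if s == t then b else sval (dP s).
have BP s : gm_piece (d s) (B s).
  by rewrite /d; case: eqP => [->|_] //; apply: (svalP (dP s)).
pose S := [seq (s, u) | s <- enum 'I_(hb_rank B), u <- msupp (hb_coord B x s)].
pose deg (su : 'I_(hb_rank B) * 'X_{1..n}) := adeg L su.2 + d su.1.
pose z (su : 'I_(hb_rank B) * 'X_{1..n}) : M :=
  ((hb_coord B x su.1)@_(su.2) *: 'X_[su.2] : R) *: B su.1.
have xE : x = \sum_(su <- S) z su.
  rewrite {1}(hb_coordE x) /S big_allpairs_dep big_enum /=.
  by apply: eq_bigr => s _; rewrite {1}(mpolyE (hb_coord B x s)) scaler_suml.
have zP su : gm_piece (deg su) (z su) by apply: gm_scale (BP _); apply: ahomogX.
have := gm_component zP xa xE.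
rewrite big_mkcond /S big_allpairs_dep big_enum /= => {}xE.
pose c s := \sum_(u <- msupp (hb_coord B x s) | adeg L u + d s == a)
  (hb_coord B x s)@_u *: 'X_[u] : R.
have -> : hb_coord B x t = c t.
  rewrite (@hb_coord_uniq x [ffun s => c s]) ?ffunE // {1}xE.
  apply: eq_bigr => s _; rewrite ffunE /c scaler_suml -big_mkcond.
  exact: eq_bigl.
move=> w; rewrite mcoeff_msupp /c raddf_sum /=; apply: contra_neq_eq => wab.
rewrite big1 // => u /eqP ua; rewrite mcoeffZ mcoeffX.
have [uw|_] := eqVneq u w; last by rewrite mulr0.
by move: wab; rewrite -uw -ua /d eqxx addrK eqxx.
Qed.

(** Each term of [y] has the degree of a term of [x], which is [a]. A kernel element of smaller
    support thus stays in the same degree. *)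
Lemma bsupp_piece a x y : gm_piece a x ->
  (forall ut, bsupp (B:=B) y ut -> bsupp (B:=B) x ut) -> gm_piece a y.
Proof.
move=> xa yx; rewrite (hb_coordE y); apply: gm_piece_sum => t _.
have [b tb] := hb_homog t; rewrite -(subrK b a); apply: (gm_scale _ tb).
by move=> u uy; apply: (hb_coord_homog xa tb); apply: (yx (u, t)).
Qed.

Lemma hb_coord_inj x y : hb_coord B x = hb_coord B y -> x = y.
Proof. by move=> xy; rewrite (hb_coordE x) xy -hb_coordE. Qed.

Lemma bsupp_neq0 x : x <> 0 -> exists ut, bsupp (B:=B) x ut.
Proof.
move=> x0; apply: NNPP => noX; apply: x0; apply: hb_coord_inj; apply/ffunP=> t.
apply/mpolyP=> u; rewrite hb_coord0 mcoeff0; apply/eqP/negPn.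
by rewrite -mcoeff_msupp; apply/negP=> ux; apply: noX; exists (u, t).
Qed.

(** The number of terms of [x], on which the search for a simple image inducts. *)
Definition bsize (x : M) : nat := \sum_t size (msupp (hb_coord B x t)).

Lemma bsupp_lt_size x y : bsupp_lt B x y -> (bsize x < bsize y)%N.
Proof.
case=> xy [[u t] /andP[uy ux]].
have le s : (size (msupp (hb_coord B x s)) <= size (msupp (hb_coord B y s)))%N.
  by apply: uniq_leq_size => // w; apply: (xy (w, s)).
rewrite /bsize (bigD1 t) //= [leqRHS](bigD1 t) //= -addSn leq_add ?leq_sum //.
have /uniq_leq_size : uniq (u :: msupp (hb_coord B x t)).
  by rewrite /= msupp_uniq andbT.
by apply=> w; rewrite inE => /predU1P[->//|]; apply: (xy (w, t)).
Qed.

(** The scalar [c] kills the term [ut], and no new term appears because [x] has none outside the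
    support of [y]. *)
Lemma bsupp_cancel x y ut : bsupp_lt B x y -> bsupp (B:=B) x ut ->
  let c := (hb_coord B y ut.2)@_(ut.1) / (hb_coord B x ut.2)@_(ut.1) in
  bsupp_lt B (y - c%:MP *: x) y.
Proof.
case: ut => u t [xy _] ux /=; set c := _ / _; split=> [[w s]|].
  rewrite /bsupp /= hb_coordB hb_coordZ !mcoeff_msupp mcoeffB mcoeffCM.
  apply: contraTneq => ys; rewrite ys sub0r.
  have: ~~ bsupp (B:=B) x (w, s).
    by apply/negP=> /xy; rewrite /bsupp /= mcoeff_msupp ys eqxx.
  by rewrite /bsupp /= mcoeff_msupp negbK => /eqP->; rewrite mulr0 oppr0 eqxx.
exists (u, t); rewrite (xy _ ux) /= /bsupp /= hb_coordB hb_coordZ.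
rewrite mcoeff_msupp negbK mcoeffB mcoeffCM divfK ?subrr //.
by rewrite -mcoeff_msupp.
Qed.

(** All coordinates of [x] lie in the ideal of the variables. *)
Lemma mM_coord0 x t : in_mM x -> (hb_coord B x t)@_0%MM = 0.
Proof.
case=> w ->; rewrite hb_coord_sum raddf_sum /= big1 // => j _.
by rewrite hb_coordZ rmorphM /= mcoeffX mnm1_eq0 mul0r.
Qed.
End Coord.

Lemma hb_homog_exchange M (B : hbasis M) t y :
  ghomog y -> forall s, ghomog (exchange (hb_vec (h:=B)) t y s).
Proof. by move=> yh s; rewrite /exchange; case: ifP => // _; apply: hb_homog. Qed.

Lemma hb_basis_exchange M (B : hbasis M) t y k :
  k * hb_coord B y t = 1 -> free_basis (exchange (hb_vec (h:=B)) t y).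
Proof.
move=> kt; have := exchange_free_basis (hb_basis B) kt.
by rewrite -hb_coordE.
Qed.

Definition hb_exchange M (B : hbasis M) t y k (yh : ghomog y)
    (kt : k * hb_coord B y t = 1) : hbasis M :=
  HBasis (hb_homog_exchange t yh) (hb_basis_exchange kt).

(** * Making the images of a basis simple under one differential *)

Section SimpleLift.
Variables (M N : gmodule K L) (phi : {linear N -> M}) (B : hbasis M).
Hypothesis hL : pointed_lattice L.
Hypothesis phi_deg : forall a x, gm_piece a x -> gm_piece a (phi x).
Hypothesis phi_min : forall x, phi x = 0 -> in_mM x.
Variable G : M -> Prop.
Hypothesis G_im : forall x, G x <-> exists y, phi y = x.

(** Since [phi] preserves degrees, the degree [a] part of any preimage of [h] already maps to
    [h]. *)
Lemma lift_homog a h : G h -> gm_piece a h ->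
  exists2 y, gm_piece a y & phi y = h.
Proof.
move=> /G_im[y yh] ha; have [s [c [cP yE]]] := gm_decomp y.
exists (\sum_(b <- s | b == a) c b).
  by apply: gm_piece_sum => b /eqP<-.
rewrite linear_sum; apply/esym/(gm_component _ ha) => [b|]; first exact: phi_deg.
by rewrite -yh yE linear_sum.
Qed.

(* Subtracting from [phi y] the multiple of a smaller kernel element that kills
   one term splits [y] into two lifts of smaller support, and the constant
   coefficient at [C t] cannot vanish on both. *)
Lemma exists_simple_lift (C : hbasis N) t a y : gm_piece a y ->
  (hb_coord C y t)@_0%MM != 0 ->
  exists y', [/\ gm_piece a y', (hb_coord C y' t)@_0%MM != 0 &
                 simple_in B G (phi y')].
Proof.
have [k] := ubnP (bsize B (phi y)); elim: k y => // k IHk y /ltnSE-lek ya yt.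
case: (classic (simple_in B G (phi y))) => [|nsimple]; first by exists y.
have [h' [Gh' h'0 _ h'lt]] : exists h', [/\ G h', h' <> 0, ghomog h' &
    bsupp_lt B h' (phi y)].
  apply: NNPP => noh; apply: nsimple; split=> //.
  - by apply/G_im; exists y.
  - by move=> /phi_min/(@mM_coord0 _ C _ t)/eqP; apply/negP.
  - by exists a; apply: phi_deg.
have [y' y'a y'h'] := lift_homog Gh' (bsupp_piece (phi_deg ya) h'lt.1).
have y'lt : bsupp_lt B (phi y') (phi y) by rewrite y'h'.
have [|y't0] := boolP ((hb_coord C y' t)@_0%MM != 0).
  by apply: IHk y'a; apply: leq_trans (bsupp_lt_size y'lt) lek.
have [ut ux] := bsupp_neq0 B h'0; rewrite -y'h' in ux.
have := bsupp_cancel y'lt ux; set c := _ / _ => /= zlt.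
apply: (IHk (y - c%:MP *: y')).
- by apply: leq_trans lek; rewrite linearB linearZ; apply: bsupp_lt_size.
- by apply: gm_pieceB => //; apply: gm_pieceZ.
rewrite hb_coordB hb_coordZ mcoeffB mcoeffCM.
by move: y't0; rewrite negbK => /eqP->; rewrite mulr0 subr0.
Qed.

Lemma exists_simple_basis : inhabited (hbasis N) ->
  exists C : hbasis N, forall t, simple_in B G (phi (C t)).
Proof.
case=> C0.
(* Induction on the number [k] of initial vectors whose images are already simple. *)
suff /(_ (hb_rank C0))[C [rC CP]] k : exists C : hbasis N,
    hb_rank C = hb_rank C0 /\
    forall t : 'I_(hb_rank C), (t < k)%N -> simple_in B G (phi (C t)).
  by exists C => t; apply: CP; rewrite -rC.
elim: k => [|k [C [rC CP]]]; first by exists C0.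
have [kr|rk] := ltnP k (hb_rank C); last first.
  by exists C; split=> // t _; apply: CP; apply: leq_trans rk.
pose t := Ordinal kr; have [a ta] := hb_homog t.
(* The search starts from [C t], whose own coordinate is 1. *)
have [|y [ya yt0 ysimple]] := @exists_simple_lift C t a (C t) ta.
  by rewrite hb_coord_vec eqxx mcoeff1 eqxx oner_neq0.
have yt : ((hb_coord C y t)@_0%MM)^-1%:MP * hb_coord C y t = 1.
  have := hb_coord_homog (t := t) ya ta; rewrite subrr => /(ahomog0_const hL)->.
  by rewrite mcoeffC eqxx mulr1 -mpolyCM mulVf.
exists (hb_exchange (ex_intro _ a ya) yt); split=> //= s.
rewrite ltnS leq_eqVlt /exchange -(inj_eq val_inj) /=.
by case: eqP => //= _; apply: CP.
Qed.

End SimpleLift.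

End Graded.

Lemma mr_kerP (K : fieldType) (n : nat) (L : zmodClosed 'rV[int]_n)
    (I : submodClosed {mpoly K[n]}^o) (F : min_resolution L I) i (x : F i) :
  mr_ker x <-> exists y, mr_diff F i y = x.
Proof. by case: i x => [|i] x; [apply: mr_exact0 | apply: mr_exactS]. Qed.

Theorem proposition2p5 (K : fieldType) (n : nat) (L : zmodClosed 'rV[int]_n)
  (hL : pointed_lattice L)
  (I : submodClosed {mpoly K[n]}^o) (hI : homog_ideal L I)
  (F : min_resolution L I) :
  exists B : forall i : nat, hbasis (F i), simple_resolution B.
Proof.
have step i (B : hbasis (F i)) : {C : hbasis (F i.+1) |
    forall t, simple_in B (@mr_ker _ _ _ _ F i) (mr_diff F i (C t))}.
  apply: constructive_indefinite_description.
  apply: exists_simple_basis (mr_free F i.+1) => //.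
  - exact: mr_diff_deg.
  (* By exactness the kernel is the image of the next differential, where minimality applies. *)
  - by move=> x /mr_exactS[y <-]; apply: mr_minimal.
  - exact: mr_kerP.
have [B0] := mr_free F 0.
(* Simplicity depends on the basis one step below, so the bases are chosen recursively from an
   arbitrary one of [F 0]. *)
exists (nat_rect (fun i => hbasis (F i)) B0 (fun i B => sval (step i B))).
by move=> i; exact: svalP (step i _).
Qed.
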